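(* Suppose that $f$ is continuously differentiable on an open set containing $\operatorname{dom}\varphi$, that $\varphi$ is proper, lower semicontinuous and prox-bounded, and that $\inf F>-\infty$. Let the algorithm described in the context be run, and suppose there exists $M_B>0$ with $\|B_k\|\le M_B$ for all $k\in\mathbb{N}_0$. Suppose further that $\nabla f$ is locally Lipschitz continuous on an open set containing $\operatorname{dom}\varphi$, i.e., for all $x\in\operatorname{dom}\varphi$ there exist $L,\varepsilon>0$ such that $\|\nabla f(y)-\nabla f(z)\|\le L\|y-z\|$ for all $y,z\in\mathbb{B}_\varepsilon(x)$. Then every accumulation point $x^*$ of $\{x^k\}$ is a stationary point, i.e., $0\in\partial F(x^* )$.
   Context: Problem: minimize $F(x):=f(x)+\varphi(x)$ over $x\in\mathbb{R}^n$, with $f:\mathbb{R}^n\to\mathbb{R}$ and $\varphi:\mathbb{R}^n\to\overline{\mathbb{R}}:=\mathbb{R}\cup\{\infty\}$. Here $\operatorname{dom}\varphi=\{x:\varphi(x)<\infty\}$; $\varphi$ is proper if $\operatorname{dom}\varphi\ne\emptyset$; $\varphi$ is prox-bounded if there exist $\gamma>0$ and $x\in\mathbb{R}^n$ with $\inf_{y}\{\varphi(y)+\frac{1}{2\gamma}\|y-x\|^2\}>-\infty$. As a standing assumption $F$ is proper and lower semicontinuous. $\partial$ denotes the limiting (Mordukhovich) subdifferential, and $\mathbb{B}_\varepsilon(x)$ is the closed Euclidean ball of radius $\varepsilon$ around $x$. Algorithm: parameters $c_1\in(0,1)$, $\sigma_2>1$, $0<\mu_{\min}\le\mu_{\max}<\infty$.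 Start with $x^0\in\operatorname{dom}\varphi$, a symmetric matrix $B_0\in\mathbb{R}^{n\times n}$ and $\mu_0\in[\mu_{\min},\mu_{\max}]$. For $k=0,1,2,\dots$ let $$q_k(x):=f(x^k)+\nabla f(x^k)^\top(x-x^k)+\tfrac12(x-x^k)^\top B_k(x-x^k)+\varphi(x),\quad G_k:=B_k+\mu_kI,\quad \hat q_k(x):=q_k(x)+\tfrac{\mu_k}{2}\|x-x^k\|^2 .$$ Search for a global minimizer $\hat x^k$ of $\hat q_k$ over $\mathbb{R}^n$. If one is found, set $d^k:=\hat x^k-x^k$, $\mathrm{ared}_k:=F(x^k)-F(\hat x^k)$, $\mathrm{pred}_k:=F(x^k)-q_k(\hat x^k)$. If $\hat x^k$ is found and $\mathrm{ared}_k\ge c_1\,\mathrm{pred}_k$ (iteration $k$ is successful), set $x^{k+1}=\hat x^k$ and choose an arbitrary symmetric $B_{k+1}\in\mathbb{R}^{n\times n}$ and an arbitrary $\mu_{k+1}\in[\mu_{\min},\mu_{\max}]$. Otherwise (unsuccessful), set $x^{k+1}=x^k$, $B_{k+1}=B_k$, $\mu_{k+1}=\sigma_2\mu_k$. Standing assumption: whenever $\hat q_k$ has a minimizer, a minimizer $\hat x^k$ is found. *)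

(* Defs.v *)
From mathcomp Require Import all_boot all_order all_algebra.
From mathcomp Require Import all_classical all_reals all_analysis.

Set Implicit Arguments.
Unset Strict Implicit.
Unset Printing Implicit Defensive.
Import Order.TTheory GRing.Theory Num.Theory.
Import numFieldNormedType.Exports.
Local Open Scope classical_set_scope.
Local Open Scope ring_scope.

(* Vectors of R^n are row vectors, so that a quadratic form reads             *)
(* u *m B *m u^T. The library norm of 'rV[R]_n is the maximum norm; it        *)
(* provides the (same) topology, but every norm written out below is the      *)
(* Euclidean one, enorm.                                                      *)

Section Euclidean.
Variables (R : realType) (n : nat).
Implicit Types (u v x : 'rV[R]_n) (B : 'M[R]_n) (f : 'rV[R]_n -> R).

Definition dotv u v : R := (u *m v^T) 0 0.

Definition enorm u : R := Num.sqrt (dotv u u).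

(* The spectral norm; acting on rows rather than columns does not change it.  *)
Definition opnorm B : R := sup [set enorm (u *m B) | u in [set u | enorm u <= 1]].

(* Meaningful at the points where f is differentiable.                        *)
Definition grad f x : 'rV[R]_n := \row_i 'd f x (delta_mx 0 i).

Definition C1_on (U : set 'rV[R]_n) f :=
  forall x, U x -> differentiable f x /\ {for x, continuous (grad f)}.

End Euclidean.

Section ExtendedRealFunctions.
Variables (R : realType) (n : nat).
Implicit Types (g F phi : 'rV[R]_n -> \bar R) (x y v : 'rV[R]_n).

Definition edom g : set 'rV[R]_n := [set x | (g x < +oo)%E].

(* Functions to R u {+oo} are modelled by functions g to \bar R with          *)
(* g x != -oo for all x, which is a separate hypothesis.                      *)
Definition proper_fun g := edom g !=set0.

Definition prox_bounded g :=
  exists gamma : R, 0 < gamma /\ exists x,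
    (-oo < ereal_inf (range
       (fun y => g y + ((2 * gamma)^-1 * enorm (y - x) ^+ 2)%:E)))%E.

Definition is_global_min g y := forall z, (g y <= g z)%E.

Definition regular_subdiff F x : set 'rV[R]_n := [set v |
  F x \is a fin_num /\
  (0 <= limf_einf (fun y => (F y - F x - (dotv v (y - x))%:E)
                            * ((enorm (y - x))^-1)%:E) x^')%E].

Definition limiting_subdiff F x : set 'rV[R]_n := [set v |
  F x \is a fin_num /\
  exists (u s : nat -> 'rV[R]_n),
    [/\ u k @[k --> \oo] --> x,
        F (u k) @[k --> \oo] --> F x,
        s k @[k --> \oo] --> v &
        forall k, regular_subdiff F (u k) (s k)]].

End ExtendedRealFunctions.

Section Algorithm.
Variables (R : realType) (n : nat).
Variables (f : 'rV[R]_n -> R) (phi : 'rV[R]_n -> \bar R).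

Definition objective (x : 'rV[R]_n) : \bar R := ((f x)%:E + phi x)%E.

Definition model (xk : 'rV[R]_n) (Bk : 'M[R]_n) (x : 'rV[R]_n) : \bar R :=
  ((f xk + dotv (grad f xk) (x - xk)
    + 2^-1 * ((x - xk) *m Bk *m (x - xk)^T) 0 0)%:E + phi x)%E.

Definition reg_model (xk : 'rV[R]_n) (Bk : 'M[R]_n) (muk : R)
    (x : 'rV[R]_n) : \bar R :=
  (model xk Bk x + (muk / 2 * enorm (x - xk) ^+ 2)%:E)%E.

Definition act_red (xk y : 'rV[R]_n) : \bar R := (objective xk - objective y)%E.

Definition pred_red (xk : 'rV[R]_n) (Bk : 'M[R]_n) (y : 'rV[R]_n) : \bar R :=
  (objective xk - model xk Bk y)%E.

(* o is the outcome of the search for a global minimizer of the regularized   *)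
(* model, None meaning that none was found.                                   *)
Definition successful (c1 : R) (xk : 'rV[R]_n) (Bk : 'M[R]_n)
    (o : option 'rV[R]_n) : Prop :=
  if o is Some y then (c1%:E * pred_red xk Bk y <= act_red xk y)%E else False.

Record algorithm_run (c1 sigma2 mumin mumax : R) (x : nat -> 'rV[R]_n)
    (B : nat -> 'M[R]_n) (mu : nat -> R) (xhat : nat -> option 'rV[R]_n)
    : Prop := AlgorithmRun {
  run_x0 : edom phi (x 0%N);
  run_B0 : (B 0%N)^T = B 0%N;
  run_mu0 : mumin <= mu 0%N <= mumax;
  run_found : forall k y, xhat k = Some y ->
    is_global_min (reg_model (x k) (B k) (mu k)) y;
  run_not_found : forall k, xhat k = None ->
    ~ exists y, is_global_min (reg_model (x k) (B k) (mu k)) y;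
  run_success : forall k, successful c1 (x k) (B k) (xhat k) ->
    [/\ xhat k = Some (x k.+1), (B k.+1)^T = B k.+1 &
        mumin <= mu k.+1 <= mumax];
  run_fail : forall k, ~ successful c1 (x k) (B k) (xhat k) ->
    [/\ x k.+1 = x k, B k.+1 = B k & mu k.+1 = sigma2 * mu k] }.

End Algorithm.

(* Main.v *)
Require Import Defs.
From mathcomp Require Import all_boot all_order all_algebra.
From mathcomp Require Import all_classical all_reals all_analysis.
From mathcomp Require Import ring lra.
Set Implicit Arguments.
Unset Strict Implicit.
Unset Printing Implicit Defensive.
Import Order.TTheory GRing.Theory Num.Theory.
Import numFieldNormedType.Exports.
Local Open Scope classical_set_scope.
Local Open Scope ring_scope.

(** Let xstar be an accumulation point. The values F(x^k) do not increase and F is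
lower semicontinuous, so xstar lies in dom phi. Hence f is differentiable with
Lipschitz gradient on a Euclidean ball around xstar.

Near xstar a large mu_k forces success. Prox-boundedness gives phi a quadratic
minorant, so for large mu_k the regularized model is coercive, uniformly in the
iterates close to xstar ([reg_model_coercive]). It therefore has a minimizer, and
every minimizer is close to x^k ([short_minimizer]). The mean value theorem
bounds the error of the model by a constant, independent of mu_k, times |d^k|^2,
whereas the predicted reduction is at least mu_k/2 |d^k|^2, so the ratio test holds once mu_k is
large ([large_mu_successful]). Consequently mu_k is bounded as long as x^k is
close to xstar ([mu_bounded_near_acc]). Since mu grows geometrically while
iterations fail, each iterate close to xstar is left by a successful iteration
([eventually_successful]).

At successful iterations c1 mu_k/2 |d^k|^2 <= F(x^k) - F(x^{k+1}), and these
differences tend to 0 because F is bounded below. So d^k tends to 0 along the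
successful iterations close to xstar. Optimality of x^{k+1} for the regularized
model says that
  grad f(x^{k+1}) - (grad f(x^k) + d^k B_k + mu_k d^k)
is a regular subgradient of F at x^{k+1} ([regular_subdiff_reg_model_min]). It
tends to 0 because B_k and mu_k are bounded. Comparing x^{k+1} with xstar in the
regularized model bounds F(x^{k+1}) from above, and lower semicontinuity bounds
it from below, so F(x^{k+1}) tends to F(xstar) and 0 is a limiting subgradient at
xstar. *)

(** * Euclidean geometry and differential calculus *)

Section EuclideanTheory.
Context {R : realType} {n : nat}.
Implicit Types (u v w x : 'rV[R]_n) (B : 'M[R]_n) (f : 'rV[R]_n -> R).

Lemma dotvE u v : dotv u v = \sum_i u 0 i * v 0 i.
Proof. by rewrite /dotv mxE; apply: eq_bigr => i _; rewrite mxE. Qed.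

Lemma dotvC u v : dotv u v = dotv v u.
Proof. by rewrite !dotvE; apply: eq_bigr => i _; rewrite mulrC. Qed.

Lemma dotvDl u v w : dotv (u + v) w = dotv u w + dotv v w.
Proof. by rewrite /dotv mulmxDl mxE. Qed.

Lemma dotvDr u v w : dotv u (v + w) = dotv u v + dotv u w.
Proof. by rewrite !(dotvC u) dotvDl. Qed.

Lemma dotvNl u v : dotv (- u) v = - dotv u v.
Proof. by rewrite /dotv mulNmx mxE. Qed.

Lemma dotvNr u v : dotv u (- v) = - dotv u v.
Proof. by rewrite !(dotvC u) dotvNl. Qed.

Lemma dotvZl a u v : dotv (a *: u) v = a * dotv u v.
Proof. by rewrite /dotv -scalemxAl mxE. Qed.

Lemma dotvZr a u v : dotv u (a *: v) = a * dotv u v.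
Proof. by rewrite !(dotvC u) dotvZl. Qed.

Lemma dotv_ge0 u : 0 <= dotv u u.
Proof. by rewrite dotvE sumr_ge0// => i _; rewrite -expr2 sqr_ge0. Qed.

Lemma dotv_sym B u v : B^T = B -> dotv (u *m B) v = dotv (v *m B) u.
Proof.
move=> symB; rewrite /dotv; have -> : u *m B *m v^T = (v *m B *m u^T)^T.
  by rewrite !trmx_mul trmxK symB mulmxA.
by rewrite mxE.
Qed.

Lemma enorm_ge0 u : 0 <= enorm u.
Proof. exact: sqrtr_ge0. Qed.

Lemma sqr_enorm u : enorm u ^+ 2 = dotv u u.
Proof. by rewrite sqr_sqrtr// dotv_ge0. Qed.

Lemma enormN u : enorm (- u) = enorm u.
Proof. by rewrite /enorm dotvNl dotvNr opprK. Qed.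

Lemma enormC u v : enorm (u - v) = enorm (v - u).
Proof. by rewrite -enormN opprB. Qed.

Lemma enormZ a u : enorm (a *: u) = `|a| * enorm u.
Proof.
rewrite /enorm dotvZl dotvZr mulrA -expr2 sqrtrM ?sqr_ge0//.
by rewrite sqrtr_sqr.
Qed.

Lemma enorm0 : enorm (0 : 'rV[R]_n) = 0.
Proof. by rewrite -(scale0r 0) enormZ normr0 mul0r. Qed.

Lemma ler_coord_enorm u i : `|u 0 i| <= enorm u.
Proof.
rewrite -(@ler_pXn2r _ 2) ?nnegrE ?enorm_ge0// sqr_enorm real_normK ?num_real//.
rewrite dotvE (bigD1 i)//= -expr2 lerDl sumr_ge0// => j _.
by rewrite -expr2 sqr_ge0.
Qed.

Lemma ler_norm_enorm u : `|u| <= enorm u.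
Proof.
rewrite [`|u|]mx_normrE; apply/bigmax_leP; split; first exact: enorm_ge0.
by move=> [i j] _ /=; rewrite ord1 ler_coord_enorm.
Qed.

Lemma ler_enorm_sum u : enorm u <= \sum_i `|u 0 i|.
Proof.
have S0 : 0 <= \sum_i `|u 0 i| by apply: sumr_ge0.
rewrite -(@ler_pXn2r _ 2) ?nnegrE ?enorm_ge0// sqr_enorm dotvE expr2 mulr_suml.
apply: ler_sum => i _; apply: (le_trans (ler_norm _)); rewrite normrM.
by rewrite ler_wpM2l// (bigD1 i)//= lerDl sumr_ge0.
Qed.

Lemma ler_enorm_norm u : enorm u <= n%:R * `|u|.
Proof.
apply: (le_trans (ler_enorm_sum u)).
rewrite -[X in X%:R]card_ord -sum1_card natr_sum mulr_suml.
apply: ler_sum => i _; rewrite mul1r [`|u|]mx_normrE.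
exact: (le_bigmax _ (fun ij : 'I_1 * 'I_n => `|u ij.1 ij.2|) (0, i)).
Qed.

Lemma enorm_eq0 u : enorm u = 0 -> u = 0.
Proof.
by move=> u0; apply/eqP; rewrite -normr_le0 -u0 ler_norm_enorm.
Qed.

Lemma cauchy_schwarz u v : `|dotv u v| <= enorm u * enorm v.
Proof.
have [u0|u0] := eqVneq (enorm u) 0.
  by rewrite (enorm_eq0 u0) -(scale0r u) dotvZl mul0r normr0 mulr_ge0 ?enorm_ge0.
have [v0|v0] := eqVneq (enorm v) 0.
  by rewrite (enorm_eq0 v0) -(scale0r v) dotvZr mul0r normr0 mulr_ge0 ?enorm_ge0.
have a0 : 0 < enorm u by rewrite lt_def u0 enorm_ge0.
have b0 : 0 < enorm v by rewrite lt_def v0 enorm_ge0.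
have ab0 := mulr_gt0 a0 b0.
have := dotv_ge0 (enorm v *: u - enorm u *: v).
have := dotv_ge0 (enorm v *: u + enorm u *: v).
rewrite !(dotvDl, dotvDr, dotvNl, dotvNr, dotvZl, dotvZr) -!sqr_enorm (dotvC v u).
set a := enorm u in a0 ab0 *; set b := enorm v in b0 ab0 *; set c := dotv u v.
move=> h1 h2; rewrite ler_norml -(ler_pM2l ab0) -(ler_pM2l ab0 c) .
by apply/andP; split; lra.
Qed.

Lemma dotv_le u v : dotv u v <= enorm u * enorm v.
Proof. exact: le_trans (ler_norm _) (cauchy_schwarz u v). Qed.

Lemma dotv_ge u v : - (enorm u * enorm v) <= dotv u v.
Proof. by rewrite lerNl -dotvNl -enormN dotv_le. Qed.

Lemma ler_enormD u v : enorm (u + v) <= enorm u + enorm v.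
Proof.
rewrite -(@ler_pXn2r _ 2) ?nnegrE ?addr_ge0 ?enorm_ge0// sqr_enorm.
rewrite dotvDl !dotvDr (dotvC v u) sqrrD -!sqr_enorm.
by have := dotv_le u v; lra.
Qed.

Lemma ler_enormB u v : enorm (u - v) <= enorm u + enorm v.
Proof. by rewrite -(enormN v) ler_enormD. Qed.

Lemma ler_enorm_dist w u v : enorm (u - v) <= enorm (u - w) + enorm (w - v).
Proof. by have := ler_enormD (u - w) (w - v); rewrite addrA subrK. Qed.

(** [opnorm] is a genuine least upper bound, not the default value of [sup] on
an unbounded set. *)
Lemma opnorm_has_ubound B :
  has_ubound [set enorm (u *m B) | u in [set u | enorm u <= 1]].
Proof.
exists (\sum_j \sum_i `|B i j|) => _ [u /= u1 <-].
apply: (le_trans (ler_enorm_sum _)); apply: ler_sum => j _.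
rewrite mxE; apply: (le_trans (ler_norm_sum _ _ _)); apply: ler_sum => i _.
by rewrite normrM ler_piMl// (le_trans (ler_coord_enorm _ _)).
Qed.

Lemma opnorm_ge0 B : 0 <= opnorm B.
Proof.
have -> : 0 = enorm (0 *m B) by rewrite mul0mx enorm0.
apply: ub_le_sup; first exact: opnorm_has_ubound.
by exists 0; rewrite //= enorm0.
Qed.

Lemma ler_enorm_opnorm B u : enorm (u *m B) <= opnorm B * enorm u.
Proof.
have [/enorm_eq0->|u0] := eqVneq (enorm u) 0.
  by rewrite mul0mx enorm0 mulr0.
have a0 : 0 < enorm u by rewrite lt_def u0 enorm_ge0.
rewrite -ler_pdivrMr// mulrC -[X in X * _]ger0_norm ?invr_ge0 ?enorm_ge0//.
rewrite -enormZ scalemxAl; apply: ub_le_sup; first exact: opnorm_has_ubound.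
exists ((enorm u)^-1 *: u) => //=.
by rewrite enormZ ger0_norm ?invr_ge0 ?enorm_ge0// mulVf.
Qed.

Lemma quad_form_le B u (M : R) : opnorm B <= M ->
  `|dotv (u *m B) u| <= M * enorm u ^+ 2.
Proof.
move=> BM; apply: (le_trans (cauchy_schwarz _ _)).
rewrite expr2 mulrA ler_wpM2r ?enorm_ge0//.
by apply: (le_trans (ler_enorm_opnorm B u)); rewrite ler_wpM2r ?enorm_ge0.
Qed.

(** The Euclidean balls generate the topology of the maximum norm. *)
Lemma nbhs_enormP x (A : set 'rV[R]_n) :
  nbhs x A <-> exists2 e : R, 0 < e & forall y, enorm (y - x) <= e -> A y.
Proof.
split=> [/nbhs_ballP[e /= e0 eA]|[e e0 eA]].
  exists (e / 2); first by rewrite divr_gt0.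
  move=> y yx; apply: eA; rewrite -ball_normE /= distrC.
  by apply: (le_lt_trans (ler_norm_enorm _)); lra.
have n1 : 0 < n%:R + 1 :> R by rewrite ltr_wpDl.
apply/nbhs_ballP; exists (e / (n%:R + 1)); first by rewrite /= divr_gt0.
move=> y; rewrite -ball_normE /= distrC => yx; apply: eA.
apply: (le_trans (ler_enorm_norm _)).
rewrite ltr_pdivlMr// in yx; have := normr_ge0 (y - x); lra.
Qed.

Lemma cvg_enormP (s : nat -> 'rV[R]_n) x :
  (forall e : R, 0 < e -> \forall k \near \oo, enorm (s k - x) <= e) ->
  s k @[k --> \oo] --> x.
Proof.
move=> H A /nbhs_enormP[e e0 eA].
by near=> k; apply: eA; near: k; exact: H.
Unshelve. all: by end_near. Qed.

Lemma diff_grad f x v : differentiable f x -> 'd f x v = dotv (grad f x) v.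
Proof.
move=> df; rewrite [in LHS](row_sum_delta v) linear_sum dotvE.
by apply: eq_bigr => i _; rewrite linearZ /= mxE mulrC.
Qed.

Lemma first_order_expansion f x (e : R) : differentiable f x -> 0 < e ->
  exists2 r : R, 0 < r & forall y, enorm (y - x) <= r ->
    `|f y - f x - dotv (grad f x) (y - x)| <= e * enorm (y - x).
Proof.
move=> df e0.
have /eqaddoP /(_ e e0) lo := diff_locally df.
have /nbhs_enormP[r r0 rP] := lo.
exists r => // y yx; have := rP (y - x); rewrite subr0 => /(_ yx).
rewrite -diff_grad// !fctE /= subrK opprD addrA => /le_trans; apply.
by rewrite ler_wpM2l ?(ltW e0)// ler_norm_enorm.
Qed.

Lemma mean_value f x v : (forall t : R, 0 <= t <= 1 -> differentiable f (x + t *: v)) ->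
  exists2 t : R, 0 <= t <= 1 & f (x + v) - f x = dotv (grad f (x + t *: v)) v.
Proof.
move=> df; pose g (t : R) := x + t *: v.
have dg (t : R) : is_derive t (1 : R) (g : R -> 'rV[R]_n) v.
  rewrite /g -[X in is_derive _ _ _ X]add0r -[X in _ + X]scale1r.
  apply: is_deriveD; have ds := is_diff_scalel t v.
  split; first by apply/derivable1_diffP; exact: ex_diff.
  by rewrite deriveE ?diff_val//; exact: ex_diff.
have dfg (t : R) : 0 <= t <= 1 ->
    is_derive t (1 : R) (f \o g) (dotv (grad f (g t)) v).
  move=> t01; have dfgt := df _ t01.
  have dgt : differentiable g t by apply/derivable1_diffP; case: (dg t).
  have dc := differentiable_comp dgt dfgt.
  split; first exact/derivable1_diffP.
  rewrite deriveE// diff_comp//= -[in 'd g t 1]deriveE//.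
  by rewrite (@derive_val _ _ _ _ _ _ _ (dg t)) diff_grad.
have [||] := @MVT_segment R (f \o g) (fun t => dotv (grad f (g t)) v) 0 1 ler01.
- by move=> t; rewrite in_itv/= => /andP[t0 t1]; apply: dfg; rewrite !ltW.
- apply: continuous_in_subspaceT => t; rewrite inE/= in_itv/= => t01.
  apply: differentiable_continuous; apply/derivable1_diffP.
  by case: (dfg t t01).
- move=> t; rewrite in_itv/= => t01; rewrite subr0 mulr1 /g /=.
  by rewrite scale1r scale0r addr0 => E; exists t.
Qed.

End EuclideanTheory.

(** * Existence of minimizers and optimality for the regularized model *)

Section Variational.
Context {R : realType} {n : nat}.
Implicit Types (u v w x y z d h g : 'rV[R]_n) (B : 'M[R]_n).
Implicit Types (f : 'rV[R]_n -> R) (F phi : 'rV[R]_n -> \bar R).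

Lemma closed_enorm_ball_compact z (r : R) :
  exists2 K : set 'rV[R]_n, compact K & forall y, enorm (y - z) <= r -> K y.
Proof.
exists (closed_ball_ Num.norm z r).
  apply: bounded_closed_compact; last exact: closed_closed_ball_.
  exists (`|z| + r); split; first exact: num_real.
  move=> M rM y /= yz; apply: (le_trans _ (ltW rM)).
  by rewrite -[y](subrK z) addrC (le_trans (ler_normD _ _))// lerD2l -normrN opprB.
by move=> y yz; rewrite /closed_ball_ /= distrC (le_trans (ler_norm_enorm _)).
Qed.

(** The sublevel sets generate a filter; it contains a compact set, and each of
its cluster points is a global minimizer. *)
Lemma lsc_bounded_level_has_min F z0 (r : R) :
  lower_semicontinuous F ->
  (forall z, (F z <= F z0)%E -> enorm (z - z0) <= r) ->
  exists y, is_global_min F y.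
Proof.
move=> lscF lev.
have [[z zNy]|noNy] := pselect (exists z, F z = -oo%E).
  by exists z => w; rewrite zNy leNye.
pose S : set_system 'rV[R]_n :=
  [set A | exists z, forall w, (F w <= F z)%E -> A w].
have PS : ProperFilter S.
  split; first by move=> -[z /(_ z)]; apply.
  split.
  - by exists z0.
  - move=> A A' [z zA] [z' zA'].
    by have [zz'|/ltW z'z] := leP (F z) (F z'); [exists z|exists z'] => w wz;
       split; (apply: zA || apply: zA') => //; apply: (le_trans wz).
  - by move=> A A' AA' [z zA]; exists z => w /zA; exact: AA'.
have [K cK KS] := closed_enorm_ball_compact z0 r.
have SK : S K by exists z0 => w /lev; exact: KS.
have [c [_ cc]] := cK S PS SK.
exists c => z; rewrite leNgt; apply/negP => zc.
move Ea : (F z) zc => [a| |] zc.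
- have [V cV VF] := lscF c a zc.
  have Sz : S [set w | (F w <= F z)%E] by exists z.
  have [w [/= wz Vw]] := cc _ _ Sz cV.
  by have := VF w Vw; rewrite -Ea ltNge wz.
- by have := leey (F c); rewrite leNgt zc.
- by apply: noNy; exists z.
Qed.

(** A strict lower bound [a] of the sum at [x] splits into a real number strictly
below [phi x] and a strict lower bound of [q x]; this uses [phi x != -oo]. *)
Lemma lsc_addl (q : 'rV[R]_n -> R) phi :
  continuous q -> (forall z, phi z != -oo%E) -> lower_semicontinuous phi ->
  lower_semicontinuous (fun z => ((q z)%:E + phi z)%E).
Proof.
move=> cq phiN lphi x a ax.
have [b bphi abq] : exists2 b : R, (b%:E < phi x)%E & a < q x + b.
  have := phiN x; move: ax; case: (phi x) => [p| |]//=.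
    rewrite -EFinD lte_fin => ax _; exists (p - (q x + p - a) / 2).
      by rewrite lte_fin; lra.
    by lra.
  by move=> _ _; exists (a - q x + 1); rewrite ?ltry//; lra.
have [V xV VF] := lphi x b bphi.
exists [set y | V y /\ a < q y + b].
  apply: filterI => //.
  have : a - b < q x by lra.
  move/(cvgr_gt _ (cq x)); apply: filterS => y /=; lra.
move=> y /= [Vy ay].
have h : (a%:E < (q y + b)%:E)%E by rewrite lte_fin.
apply: (lt_trans h).
rewrite EFinD lteD2lE//; exact: VF.
Qed.

(** The smooth part of the regularized model, as a function of the step [d] and
without its constant term. *)
Definition quad_model g B (mu : R) d : R :=
  dotv g d + 2^-1 * dotv (d *m B) d + mu / 2 * enorm d ^+ 2.

Lemma reg_modelE f phi x B (mu : R) z :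
  reg_model f phi x B mu z = ((f x + quad_model (grad f x) B mu (z - x))%:E + phi z)%E.
Proof.
rewrite /reg_model /model addeAC -EFinD /quad_model; congr (_%:E + _)%E.
by rewrite -!addrA.
Qed.

Lemma quad_modelD g B (mu : R) d h : B^T = B ->
  quad_model g B mu (d + h) = quad_model g B mu d
   + dotv (g + d *m B + mu *: d) h + 2^-1 * dotv (h *m B) h + mu / 2 * enorm h ^+ 2.
Proof.
move=> symB; rewrite /quad_model !sqr_enorm mulmxDl !(dotvDl, dotvDr, dotvZl).
by rewrite (dotv_sym h d symB) (dotvC h d); field.
Qed.

Lemma quad_rem_le B (mu M : R) h : opnorm B <= M ->
  `|2^-1 * dotv (h *m B) h + mu / 2 * enorm h ^+ 2| <= (M + `|mu|) * enorm h ^+ 2.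
Proof.
move=> BM; have := quad_form_le h BM; have := sqr_ge0 (enorm h).
move: (dotv _ _) (enorm h ^+ 2) => q e e0 qM.
apply: (le_trans (ler_normD _ _)); rewrite !normrM (ger0_norm e0).
rewrite (@ger0_norm _ (2^-1 : R)) ?invr_ge0// mulrDl; apply: lerD.
  by have := normr_ge0 q; lra.
by rewrite ler_wpM2r// ler_piMr//; lra.
Qed.

Lemma quad_model_continuous (c : R) g B (mu : R) x : B^T = B ->
  continuous (fun z => c + quad_model g B mu (z - x)).
Proof.
move=> symB z; apply/(@cvgrPdist_le _ _ _ _ (nbhs_filter z)) => e e0.
pose G := enorm (g + (z - x) *m B + mu *: (z - x)) + (opnorm B + `|mu|).
have op0 := opnorm_ge0 B.
have G0 : 0 <= G by rewrite !addr_ge0// enorm_ge0.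
apply/nbhs_enormP; exists (Num.min 1 (e / (G + 1))).
  by rewrite lt_min ltr01 divr_gt0// ltr_wpDl.
move=> y /=; rewrite le_min => /andP[y1 ye].
have -> : y - x = (z - x) + (y - z) by rewrite [RHS]addrC addrA subrK.
rewrite (quad_modelD _ _ (z - x) (y - z))//.
have normE (a b p q r : R) : `|r + a - (r + (a + b + p + q))| = `|b + (p + q)|.
  by rewrite -normrN; congr `|_|; ring.
rewrite normE.
set h := y - z in y1 ye *.
apply: (le_trans (ler_normD _ _)).
have h0 := enorm_ge0 h.
have := quad_rem_le mu h (lexx (opnorm B)).
have := cauchy_schwarz (g + (z - x) *m B + mu *: (z - x)) h.
rewrite ler_pdivlMr ?ltr_wpDl// in ye.
have : (opnorm B + `|mu|) * enorm h ^+ 2 <= (opnorm B + `|mu|) * enorm h.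
  by rewrite ler_wpM2l ?addr_ge0// expr2 ler_piMr.
rewrite mulrDr mulr1 /G mulrDr in ye; lra.
Qed.

(** A first-order lower estimate with arbitrarily small slope error yields a
regular subgradient. *)
Lemma regular_subdiffP F x v (a : R) : F x = a%:E ->
  (forall e : R, 0 < e -> exists2 r : R, 0 < r & forall y, enorm (y - x) <= r ->
     ((a + dotv v (y - x) - e * enorm (y - x))%:E <= F y)%E) ->
  regular_subdiff F x v.
Proof.
move=> Fx H; split; first by rewrite Fx.
set Q := fun y => _; rewrite limf_einfE.
apply/lee_addgt0Pr => e e0; rewrite -leeBlDr// sub0e.
have [r r0 Hr] := H e e0.
apply: le_ereal_sup_tmp.
exists (ereal_inf (Q @` [set y | y != x /\ enorm (y - x) <= r])).
  exists [set y | y != x /\ enorm (y - x) <= r] => //.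
  by apply/nbhs_enormP; exists r => // y yx /= ynx.
apply: le_ereal_inf_tmp => _ [y [/= ynx yx] <-]; rewrite /Q.
have e1 : 0 < enorm (y - x).
  rewrite lt_def enorm_ge0 andbT; apply: contra ynx => /eqP/enorm_eq0/eqP.
  by rewrite subr_eq0.
have := Hr y yx; rewrite Fx; case: (F y) => [b| |]//=.
  rewrite lee_fin -!EFinD -EFinM lee_fin => ab.
  by rewrite ler_pdivlMr//; lra.
by move=> _; rewrite gt0_mulye ?leey ?lte_fin ?invr_gt0.
Qed.

(** Fermat's rule: [phi] is bounded below by minus the smooth part of the
model, up to a constant, with equality at [y]; adding the expansion of [f] at
[y] gives the subgradient. *)
Lemma regular_subdiff_reg_model_min f phi x B (mu : R) y :
  (forall z, phi z != -oo%E) -> phi y \is a fin_num -> B^T = B ->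
  differentiable f y -> is_global_min (reg_model f phi x B mu) y ->
  regular_subdiff (objective f phi) y
    (grad f y - (grad f x + (y - x) *m B + mu *: (y - x))).
Proof.
move=> phiN yfin symB dfy miny.
move: yfin; case Ey : (phi y) => [p| |]// _.
apply: (@regular_subdiffP _ _ _ (f y + p)); first by rewrite /objective Ey.
move=> e e0; have e20 : 0 < e / 2 by rewrite divr_gt0.
have [r r0 Hr] := first_order_expansion dfy e20.
pose C := opnorm B + `|mu|; have C0 : 0 <= C by rewrite addr_ge0// opnorm_ge0.
exists (Num.min r (e / 2 / (C + 1))).
  by rewrite lt_min r0 divr_gt0// ltr_wpDl.
move=> z; rewrite le_min => /andP[zr zC]; rewrite /objective.
have := phiN z; have := miny z; rewrite !reg_modelE Ey.
case: (phi z) => [q| |]//= h _; last by rewrite addey// leey.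
move: h; rewrite -!EFinD !lee_fin.
have -> : z - x = (y - x) + (z - y) by rewrite [RHS]addrC addrA subrK.
rewrite (quad_modelD _ _ (y - x) (z - y))// => h.
have := Hr _ zr; rewrite ler_norml => /andP[h1 _].
have := quad_rem_le mu (z - y) (lexx (opnorm B)).
rewrite ler_norml => /andP[_ h2].
have z0 := enorm_ge0 (z - y).
rewrite ler_pdivlMr ?ltr_wpDl// in zC.
have h3 : C * enorm (z - y) ^+ 2 <= e / 2 * enorm (z - y).
  rewrite expr2 mulrA ler_wpM2r//; lra.
by rewrite dotvDl dotvNl; rewrite -/C in h2; lra.
Qed.

End Variational.

(** * Limiting subgradients from approximate data *)

Section LimitingSubdifferential.
Context {R : realType} {n : nat}.
Implicit Types (F : 'rV[R]_n -> \bar R).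

Lemma limiting_subdiffP F x v (a : R) : F x = a%:E ->
  (forall e : R, 0 < e -> exists y w b,
     [/\ enorm (y - x) <= e, enorm (w - v) <= e, F y = b%:E, `|b - a| <= e
       & regular_subdiff F y w]) ->
  limiting_subdiff F x v.
Proof.
move=> Fx H; split; first by rewrite Fx.
have inv0 (k : nat) : 0 < k.+1%:R^-1 :> R by rewrite invr_gt0.
have [u uP] := choice (fun k => H _ (inv0 k)).
have [s sP] := choice uP; have {sP}[b bP] := choice sP.
have small (e : R) : 0 < e -> \forall k \near \oo, k.+1%:R^-1 <= e.
  by move=> e0; apply: filterS (near_infty_natSinv_lt (PosNum e0)) => k /ltW.
exists u, s; split.
- apply: cvg_enormP => e /small; apply: filterS => k; apply: le_trans.
  by have [] := bP k.
- rewrite Fx; apply/fine_cvgP; split.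
    by apply: nearW => k; have [_ _ -> _ _] := bP k.
  apply/cvgrPdist_le => e /small; apply: filterS => k; apply: le_trans.
  by have [_ _ /= -> + _] := bP k; rewrite distrC.
- apply: cvg_enormP => e /small; apply: filterS => k; apply: le_trans.
  by have [] := bP k.
- by move=> k; have [] := bP k.
Qed.

End LimitingSubdifferential.

(** * Coercivity of the model and local bounds on the smooth part *)

Section LocalEstimates.
Context {R : realType} {n : nat}.
Variables (f : 'rV[R]_n -> R) (phi : 'rV[R]_n -> \bar R).

Lemma prox_bounded_quad_minorant : prox_bounded phi ->
  exists a b p, 0 <= a /\ forall z, ((b - a * enorm (z - p) ^+ 2)%:E <= phi z)%E.
Proof.
move=> [gam [gam0 [p infp]]].
have [b bP] : exists b : R, forall y,
    (b%:E <= phi y + ((2 * gam)^-1 * enorm (y - p) ^+ 2)%:E)%E.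
  move: infp; set I := ereal_inf _ => infp.
  have IP y : (I <= phi y + ((2 * gam)^-1 * enorm (y - p) ^+ 2)%:E)%E.
    by apply: ereal_inf_lbound; exists y.
  move: infp IP; case: I => [b _ bP|_ bP|//]; first by exists b.
  by exists 0 => y; apply: (le_trans _ (bP y)); rewrite leey.
exists (2 * gam)^-1, b, p; split; first by rewrite invr_ge0 mulr_ge0// ltW.
by move=> z; rewrite EFinB leeBlDr.
Qed.

(** The constants [a] and [b] do not depend on the center [w], the gradient [g],
the matrix [B] or the parameter [mu]; this uniformity is what turns a large
[mu] into a short step. *)
Lemma reg_model_coercive (M G rho : R) (xs : 'rV[R]_n) :
  prox_bounded phi -> exists a b, forall w g B mu z,
    enorm (w - xs) <= rho -> enorm g <= G -> opnorm B <= M ->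
    (((mu / 2 - a) * enorm (z - w) ^+ 2 - b)%:E
       <= (quad_model g B mu (z - w))%:E + phi z)%E.
Proof.
move=> /prox_bounded_quad_minorant[a0 [b0 [p [a00 H]]]].
pose c := rho + enorm (xs - p).
exists (2^-1 + M / 2 + 2 * a0), (G ^+ 2 / 2 - b0 + 2 * a0 * c ^+ 2).
move=> w g B mu z wxs gG BM.
apply: (le_trans _ (leeD2l _ (H z))); rewrite -EFinD lee_fin /quad_model.
have := quad_form_le (z - w) BM; rewrite ler_norml => /andP[h1 _].
have h2 := dotv_ge g (z - w).
have d0 := enorm_ge0 (z - w).
(* Young's inequality absorbs the linear term. *)
have h3 : enorm g * enorm (z - w) <= G ^+ 2 / 2 + enorm (z - w) ^+ 2 / 2.
  have := sqr_ge0 (G - enorm (z - w)); rewrite sqrrB.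
  have : enorm g * enorm (z - w) <= G * enorm (z - w) by rewrite ler_wpM2r.
  lra.
have wp : enorm (w - p) <= c by rewrite (le_trans (ler_enorm_dist xs _ _))// lerD2r.
clearbody c.
have h4 : enorm (z - p) ^+ 2 <= 2 * enorm (z - w) ^+ 2 + 2 * c ^+ 2.
  have := ler_enorm_dist w z p => zp.
  have {zp}zp : enorm (z - p) <= enorm (z - w) + c by lra.
  have c0 : 0 <= c by rewrite (le_trans _ wp)// enorm_ge0.
  have : enorm (z - p) ^+ 2 <= (enorm (z - w) + c) ^+ 2.
    by rewrite ler_pXn2r ?nnegrE ?enorm_ge0 ?(addr_ge0 d0 c0).
  by have := sqr_ge0 (enorm (z - w) - c); rewrite sqrrB sqrrD; lra.
have h5 : a0 * enorm (z - p) ^+ 2 <= a0 * (2 * enorm (z - w) ^+ 2 + 2 * c ^+ 2).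
  by rewrite ler_wpM2l.
lra.
Qed.

Lemma enorm_segment (z y w : 'rV[R]_n) (eps t : R) : 0 <= t <= 1 ->
  enorm (y - z) <= eps -> enorm (w - z) <= eps ->
  enorm (w + t *: (y - w) - z) <= eps.
Proof.
move=> /andP[t0 t1] yz wz.
have -> : w + t *: (y - w) - z = t *: (y - z) + (1 - t) *: (w - z).
  by rewrite !scalerBr !scalerBl !scale1r; apply/rowP => i; rewrite !mxE; ring.
apply: (le_trans (ler_enormD _ _)); rewrite !enormZ (ger0_norm t0).
rewrite ger0_norm ?subr_ge0//.
have : t * enorm (y - z) <= t * eps by rewrite ler_wpM2l.
have : (1 - t) * enorm (w - z) <= (1 - t) * eps by rewrite ler_wpM2l ?subr_ge0.
lra.
Qed.

(** The mean value theorem gives the first-order error with constant [L] rather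
than the sharp [L / 2], which is enough. *)
Lemma lipschitz_grad_bounds z (L eps : R) :
  0 <= L ->
  (forall y, enorm (y - z) <= eps -> differentiable f y) ->
  (forall y w, enorm (y - z) <= eps -> enorm (w - z) <= eps ->
     enorm (grad f y - grad f w) <= L * enorm (y - w)) ->
  forall y w, enorm (y - z) <= eps -> enorm (w - z) <= eps ->
  [/\ enorm (grad f y) <= enorm (grad f z) + L * eps,
      `|f y - f w| <= (enorm (grad f z) + L * eps) * enorm (y - w) &
      `|f y - f w - dotv (grad f w) (y - w)| <= L * enorm (y - w) ^+ 2].
Proof.
move=> L0 df lip y w yz wz.
have eps0 : 0 <= eps := le_trans (enorm_ge0 _) yz.
have gb v : enorm (v - z) <= eps ->
    enorm (grad f v) <= enorm (grad f z) + L * eps.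
  move=> vz; rewrite -[grad f v](subrK (grad f z)) addrC.
  apply: (le_trans (ler_enormD _ _)); rewrite lerD2l.
  apply: (le_trans (lip _ _ vz _)); first by rewrite subrr enorm0.
  by rewrite ler_wpM2l.
have [|t t01] := @mean_value _ _ f w (y - w).
  by move=> t t01; apply/df/enorm_segment.
have xiz := enorm_segment t01 yz wz; set xi := w + _ in xiz *.
rewrite [w + (y - w)]addrC subrK => E; split; first exact: gb.
  rewrite E; apply: (le_trans (cauchy_schwarz _ _)).
  by rewrite ler_wpM2r ?enorm_ge0// gb.
rewrite E -dotvNl -dotvDl; apply: (le_trans (cauchy_schwarz _ _)).
rewrite expr2 mulrA ler_wpM2r ?enorm_ge0//.
apply: (le_trans (lip _ _ xiz wz)); rewrite ler_wpM2l//.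
rewrite /xi [w + _]addrC addrK enormZ.
case/andP: t01 => t0 t1.
by rewrite ger0_norm// ler_piMl// enorm_ge0.
Qed.

End LocalEstimates.

(** * The iterates of the algorithm *)

Section AlgorithmRun.
Context {R : realType} {n : nat}.
Variables (f : 'rV[R]_n -> R) (phi : 'rV[R]_n -> \bar R).
Variables (c1 sigma2 mumin mumax : R).
Variables (x : nat -> 'rV[R]_n) (B : nat -> 'M[R]_n) (mu : nat -> R).
Variable xhat : nat -> option 'rV[R]_n.
Hypothesis phi_ninfty : forall z, phi z != -oo%E.
Hypothesis c1_gt0 : 0 < c1.
Hypothesis c1_lt1 : c1 < 1.
Hypothesis sigma2_gt1 : 1 < sigma2.
Hypothesis mumin_gt0 : 0 < mumin.
Hypothesis run : algorithm_run f phi c1 sigma2 mumin mumax x B mu xhat.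

(** Iteration [k] is successful. *)
Let succ k := successful f phi c1 (x k) (B k) (xhat k).

Lemma min_reg_model_dom w C (m : R) y : edom phi w ->
  is_global_min (reg_model f phi w C m) y -> edom phi y.
Proof.
move=> dw /(_ w); rewrite !reg_modelE /edom /=.
move: dw; rewrite /edom /=; case: (phi w) (phi_ninfty w) => [p| |]//= _ _.
by rewrite -EFinD; case: (phi y) => [q| |]//; rewrite ?ltry// addey// leye_eq.
Qed.

Lemma run_edom k : edom phi (x k).
Proof.
elim: k => [|k IH]; first exact: run_x0 run.
have [s|s] := pselect (succ k); last by have [->] := run_fail run s.
have [E _ _] := run_success run s.
exact: min_reg_model_dom IH (run_found run E).
Qed.

Lemma run_sym k : (B k)^T = B k.
Proof.
elim: k => [|k IH]; first exact: run_B0 run.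
have [s|s] := pselect (succ k); first by have [] := run_success run s.
by have [_ -> _] := run_fail run s.
Qed.

Lemma run_mu_ge k : mumin <= mu k.
Proof.
elim: k => [|k IH]; first by case/andP: (run_mu0 run).
have [s|s] := pselect (succ k).
  by have [_ _ /andP[]] := run_success run s.
have [_ _ ->] := run_fail run s.
by rewrite (le_trans IH)// ler_peMl ?(ltW sigma2_gt1)// (le_trans (ltW mumin_gt0)).
Qed.

(** The value of [phi] at the k-th iterate, as a real number: the iterates stay in
the domain of [phi]. *)
Definition phi_val k : R := fine (phi (x k)).

(** The value of the objective at the k-th iterate, as a real number. *)
Definition obj_val k : R := f (x k) + phi_val k.

Lemma phi_valE k : phi (x k) = (phi_val k)%:E.
Proof.
rewrite /phi_val fineK// fin_numE phi_ninfty/=.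
by apply/eqP => E; have := run_edom k; rewrite /edom /= E.
Qed.

Lemma obj_valE k : objective f phi (x k) = (obj_val k)%:E.
Proof. by rewrite /objective phi_valE. Qed.

Lemma quad_model0 g C (m : R) : quad_model g C m (0 : 'rV[R]_n) = 0.
Proof.
by rewrite /quad_model enorm0 /dotv trmx0 !mulmx0 !mxE expr0n/= !mulr0 !addr0.
Qed.

Lemma min_reg_model_le w C (m : R) y z (p q : R) :
  is_global_min (reg_model f phi w C m) y -> phi y = p%:E -> phi z = q%:E ->
  quad_model (grad f w) C m (y - w) + p <= quad_model (grad f w) C m (z - w) + q.
Proof.
move=> /(_ z) + Ey Ez; rewrite !reg_modelE Ey Ez.
by rewrite -!EFinD lee_fin -!addrA lerD2l.
Qed.

(** The ratio test in real terms; [quad_model] with parameter 0 is the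
unregularized model. *)
Lemma successfulE w C y (p q : R) : phi w = p%:E -> phi y = q%:E ->
  successful f phi c1 w C (Some y) <->
  c1 * (p - (quad_model (grad f w) C 0 (y - w) + q)) <= f w + p - (f y + q).
Proof.
move=> Ep Eq; rewrite /successful /act_red /pred_red /objective /model Ep Eq.
rewrite -!EFinD -EFinM lee_fin /quad_model mul0r mul0r addr0.
set r := dotv _ _; set s := 2^-1 * _.
by have -> : f w + p - (f w + r + s + q) = p - (r + s + q) by ring.
Qed.

Lemma quad_model_mu g C (m : R) (d : 'rV[R]_n) :
  quad_model g C m d = quad_model g C 0 d + m / 2 * enorm d ^+ 2.
Proof. by rewrite /quad_model !mul0r addr0. Qed.

Lemma success_step k : succ k ->
  is_global_min (reg_model f phi (x k) (B k) (mu k)) (x k.+1) /\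
  c1 * (mu k / 2 * enorm (x k.+1 - x k) ^+ 2) <= obj_val k - obj_val k.+1.
Proof.
move=> s; have [E _ _] := run_success run s.
have m := run_found run E; split=> //.
move: s; rewrite /succ E => /(successfulE _ (phi_valE k) (phi_valE k.+1)).
apply: le_trans; rewrite ler_pM2l//.
have := min_reg_model_le m (phi_valE k.+1) (phi_valE k).
by rewrite subrr quad_model0 quad_model_mu; lra.
Qed.

Lemma obj_val_decr k : obj_val k.+1 <= obj_val k.
Proof.
have [s|s] := pselect (succ k); last first.
  by rewrite /obj_val /phi_val; have [-> _ _] := run_fail run s.
have [_] := success_step s.
have : 0 <= c1 * (mu k / 2 * enorm (x k.+1 - x k) ^+ 2).
  rewrite mulr_ge0 ?(ltW c1_gt0)// mulr_ge0 ?sqr_ge0// divr_ge0//.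
  exact: le_trans (ltW mumin_gt0) (run_mu_ge k).
lra.
Qed.

Lemma obj_val_mono k l : (k <= l)%N -> obj_val l <= obj_val k.
Proof.
move=> kl; rewrite -(subnK kl); elim: (l - k)%N => [|j IH]; first by rewrite add0n.
by rewrite addSn (le_trans (obj_val_decr _)).
Qed.

Hypothesis F_bounded_below : (-oo < ereal_inf (range (objective f phi)))%E.

Lemma obj_val_diff_small (e : R) : 0 < e ->
  exists N, forall k, (N <= k)%N -> obj_val k - obj_val k.+1 < e.
Proof.
move=> e0; have [b bP] : exists b, forall k, b <= obj_val k.
  move: F_bounded_below; set I := ereal_inf _ => infp.
  have IP k : (I <= (obj_val k)%:E)%E.
    by rewrite -obj_valE; apply: ereal_inf_lbound; exists (x k).
  move: infp IP; case: I => [b _ bP| _ bP|//].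
    by exists b => k; rewrite -lee_fin.
  by exists 0 => k; have := bP k; rewrite leye_eq.
have infO : has_inf (range obj_val).
  split; first by exists (obj_val 0%N), 0%N.
  by exists b => _ [k _ <-].
have [_ [N _ <-] NP] := inf_adherent e0 infO.
exists N => k Nk.
have := obj_val_mono Nk.
have : inf (range obj_val) <= obj_val k.+1 by apply: ge_inf; [case: infO|exists k.+1].
lra.
Qed.

Hypothesis F_lsc : lower_semicontinuous (objective f phi).
Variable xstar : 'rV[R]_n.
Hypothesis xstar_acc : cluster (x k @[k --> \oo]) xstar.

Lemma acc_frequently (e : R) N : 0 < e ->
  exists2 k, (N <= k)%N & enorm (x k - xstar) <= e.
Proof.
move=> e0.
have xA : (x k @[k --> \oo]) [set y | exists2 k, (N <= k)%N & y = x k].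
  by exists N => // k /= Nk; exists k.
have nA : nbhs xstar [set y | enorm (y - xstar) <= e].
  by apply/nbhs_enormP; exists e.
by have [_ [[k Nk ->] /= ke]] := xstar_acc xA nA; exists k.
Qed.

Lemma acc_edom : edom phi xstar.
Proof.
rewrite /edom /= ltey; apply/eqP => E.
have [V /nbhs_enormP[e e0 eV] VF] : exists2 V, nbhs xstar V &
    forall y, V y -> ((obj_val 0)%:E < objective f phi y)%E.
  by apply: F_lsc; rewrite /objective E addey// ltry.
have [k _ /eV /VF] := acc_frequently 0 e0.
by rewrite obj_valE lte_fin ltNge obj_val_mono.
Qed.

Hypothesis phi_lsc : lower_semicontinuous phi.
Hypothesis phi_prox_bounded : prox_bounded phi.
Variables (MB L eps : R).
Hypothesis B_bounded : forall k, opnorm (B k) <= MB.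
Hypothesis eps_gt0 : 0 < eps.
Hypothesis L_gt0 : 0 < L.
Hypothesis f_diff : forall y, enorm (y - xstar) <= eps -> differentiable f y.
Hypothesis grad_lip : forall y w, enorm (y - xstar) <= eps ->
  enorm (w - xstar) <= eps -> enorm (grad f y - grad f w) <= L * enorm (y - w).

Let G := enorm (grad f xstar) + L * eps.

Let f_local y w (yx : enorm (y - xstar) <= eps) (wx : enorm (w - xstar) <= eps) :=
  lipschitz_grad_bounds (ltW L_gt0) f_diff grad_lip yx wx.

Let MB_ge0 : 0 <= MB.
Proof. exact: le_trans (opnorm_ge0 _) (B_bounded 0). Qed.

Let star_close : enorm (xstar - xstar) <= eps.
Proof. by rewrite subrr enorm0 ltW. Qed.

(** For large [mu k] the search finds a minimizer, because the level set of the
current iterate is bounded, and the step is short, because that level set lies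
in the ball of radius [eps / 2] around the iterate. *)
Lemma short_minimizer : exists mubar : R, forall k,
  enorm (x k - xstar) <= eps / 2 -> mubar <= mu k ->
  exists2 y, xhat k = Some y & enorm (y - x k) <= eps / 2.
Proof.
have [a [b ab]] := reg_model_coercive MB G (eps / 2) xstar phi_prox_bounded.
pose T := `|b + (obj_val 0 - f xstar + G * eps)| + 1.
have T1 : 1 <= T by rewrite lerDr.
pose r2 := (eps / 2) ^+ 2; have r20 : 0 < r2 by rewrite exprn_gt0// divr_gt0.
exists (2 * (a + T / r2)) => k kx mk.
have ksmall : enorm (x k - xstar) <= eps.
  by have := eps_gt0; lra.
(* The values of f near xstar and the monotonicity of the objective bound
   phi along the nearby iterates, uniformly in k. *)
have Pk : b + phi_val k < T.
  have [_ + _] := f_local ksmall star_close; rewrite ler_norml -/G => /andP[h _].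
  have G0 : 0 <= G by rewrite addr_ge0 ?enorm_ge0// mulr_ge0// ltW.
  have : G * enorm (x k - xstar) <= G * eps by rewrite ler_wpM2l.
  have := obj_val_mono (leq0n k); rewrite {1}/obj_val.
  have := ler_norm (b + (obj_val 0 - f xstar + G * eps)); rewrite /T; lra.
have gk : enorm (grad f (x k)) <= G by have [] := f_local ksmall star_close.
have level z :
    (reg_model f phi (x k) (B k) (mu k) z <= reg_model f phi (x k) (B k) (mu k) (x k))%E ->
    enorm (z - x k) <= eps / 2.
  rewrite !reg_modelE phi_valE subrr quad_model0 addr0.
  move=> h.
  have h' : ((quad_model (grad f (x k)) (B k) (mu k) (z - x k))%:E + phi z
             <= (phi_val k)%:E)%E.
    by move: h; rewrite EFinD -addeA leeD2lE.
  have := le_trans (ab (x k) (grad f (x k)) (B k) (mu k) z kx gk (B_bounded k)) h'.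
  rewrite lee_fin => {h h'} h.
  rewrite leNgt; apply/negP => big.
  have : r2 < enorm (z - x k) ^+ 2.
    by rewrite ltr_pXn2r ?nnegrE ?enorm_ge0// divr_ge0// ltW.
  have : T / r2 * enorm (z - x k) ^+ 2 <= (mu k / 2 - a) * enorm (z - x k) ^+ 2.
    by rewrite ler_wpM2r ?sqr_ge0//; lra.
  move=> h1 h2.
  have : T / r2 * r2 < T / r2 * enorm (z - x k) ^+ 2.
    by rewrite ltr_pM2l// divr_gt0//; lra.
  rewrite divfK ?gt_eqF//; lra.
have [y ymin] : exists y, is_global_min (reg_model f phi (x k) (B k) (mu k)) y.
  apply: (@lsc_bounded_level_has_min _ _ _ (x k) (eps / 2)) => //.
  have -> : reg_model f phi (x k) (B k) (mu k) = fun z =>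
      ((f (x k) + quad_model (grad f (x k)) (B k) (mu k) (z - x k))%:E + phi z)%E.
    by apply/funext => z; rewrite reg_modelE.
  apply: lsc_addl => // z.
  exact: quad_model_continuous (run_sym k) z.
case E : (xhat k) => [y'|]; last by case: (run_not_found run E); exists y.
by exists y' => //; apply: level; have := run_found run E; apply.
Qed.

Lemma large_mu_successful : exists2 mubar : R, 0 < mubar & forall k,
  enorm (x k - xstar) <= eps / 2 -> mubar <= mu k -> succ k.
Proof.
have [m0 m0P] := short_minimizer.
(* With mu >= m1 the part (1 - c1) * pred of the predicted reduction dominates
   the model error (L + MB / 2) * |d|^2. *)
pose m1 := (2 * L + MB) / (1 - c1).
exists (Num.max 1 (Num.max m0 m1)); first by rewrite lt_max ltr01.
move=> k kx; rewrite !ge_max => /and3P[_ mk0 mk1].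
have [y E ysmall] := m0P k kx mk0; rewrite /succ E.
have ymin := run_found run E.
have ksmall : enorm (x k - xstar) <= eps.
  by have := eps_gt0; lra.
have yx : enorm (y - xstar) <= eps.
  by apply: (le_trans (ler_enorm_dist (x k) _ _)); lra.
have [q Eq] : exists q, phi y = q%:E.
  have := min_reg_model_dom (run_edom k) ymin; rewrite /edom /=.
  by have := phi_ninfty y; case: (phi y) => // q; exists q.
apply/(successfulE _ (phi_valE k) Eq).
have := min_reg_model_le ymin Eq (phi_valE k).
rewrite subrr quad_model0 quad_model_mu /quad_model mul0r mul0r addr0.
have [_ _] := f_local yx ksmall; rewrite ler_norml => /andP[_].
have := quad_form_le (y - x k) (B_bounded k); rewrite ler_norml => /andP[h1 _].
rewrite /m1 ler_pdivrMr ?subr_gt0// in mk1.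
have := sqr_ge0 (enorm (y - x k)).
move: (enorm _ ^+ 2) (dotv _ _) (dotv _ _) h1 => D g r h1 D0 h2 h3.
have : (2 * L + MB) * D <= mu k * (1 - c1) * D by rewrite ler_wpM2r.
have c1' : 0 <= 1 - c1 by rewrite subr_ge0 ltW.
have : (1 - c1) * (mu k / 2 * D) <= (1 - c1) * (phi_val k - (g + 2^-1 * r + q)).
  by rewrite ler_wpM2l//; lra.
lra.
Qed.

(** A successful iteration resets [mu] below [mumax]. An unsuccessful one leaves
the iterate in place, so [mu] was below the threshold before being
multiplied. *)
Lemma mu_bounded_near_acc : exists2 Mu : R, 0 < Mu & forall k,
  enorm (x k - xstar) <= eps / 2 -> mu k <= Mu.
Proof.
have [m m0 mP] := large_mu_successful.
have s0 : 0 < sigma2 by apply: lt_trans sigma2_gt1.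
exists (Num.max mumax (sigma2 * m)); first by rewrite lt_max mulr_gt0// orbT.
case=> [_|k kx]; first by rewrite le_max; case/andP: (run_mu0 run) => _ ->.
have [s|s] := pselect (succ k).
  by have [_ _ /andP[_ h]] := run_success run s; rewrite le_max h.
have [E _ ->] := run_fail run s; rewrite E in kx.
rewrite le_max ler_pM2l//; apply/orP; right; rewrite leNgt.
by apply/negP => /ltW/(mP _ kx).
Qed.

(** Otherwise the iterate would stay forever and [mu] would exceed its bound. *)
Lemma eventually_successful k : enorm (x k - xstar) <= eps / 2 ->
  exists l, [/\ (k <= l)%N, x l = x k & succ l].
Proof.
move=> kx; apply: contrapT => H.
have [Mu Mu0 MuP] := mu_bounded_near_acc.
have stay j : x (k + j) = x k /\ mu k + j%:R * ((sigma2 - 1) * mumin) <= mu (k + j).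
  elim: j => [|j [xj muj]]; first by rewrite addn0 mul0r addr0.
  have s : ~ succ (k + j)%N.
    by move=> s; apply: H; exists (k + j)%N; rewrite leq_addr.
  have [E _ mE] := run_fail run s; rewrite addnS E; split=> //.
  rewrite mE -natr1.
  have : (sigma2 - 1) * mumin <= (sigma2 - 1) * mu (k + j)%N.
    by rewrite ler_wpM2l ?run_mu_ge// subr_ge0 ltW.
  lra.
have d0 : 0 < (sigma2 - 1) * mumin by rewrite mulr_gt0// subr_gt0.
have [j jP] : exists j : nat, Mu / ((sigma2 - 1) * mumin) < j%:R.
  by exists (Num.truncn (Mu / ((sigma2 - 1) * mumin))).+1; exact: truncnS_gt.
rewrite ltr_pdivrMr// in jP.
have [xj muj] := stay j; have := MuP (k + j)%N; rewrite xj => /(_ kx).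
have := run_mu_ge k; have := mumin_gt0; lra.
Qed.

Lemma acc_stationary : limiting_subdiff (objective f phi) xstar 0.
Proof.
have [Ps EPs] : exists p, phi xstar = p%:E.
  have := acc_edom; rewrite /edom /=.
  by have := phi_ninfty xstar; case: (phi xstar) => // p _ _; exists p.
have EF : objective f phi xstar = (f xstar + Ps)%:E by rewrite /objective EPs.
apply: (limiting_subdiffP EF) => e e0.
have [Mu Mu0 MuP] := mu_bounded_near_acc.
have [V /nbhs_enormP[r r0 rV] VF] : exists2 V, nbhs xstar V &
    forall y, V y -> ((f xstar + Ps - e)%:E < objective f phi y)%E.
  by apply: F_lsc; rewrite EF lte_fin; lra.
have G0 : 0 <= G by rewrite addr_ge0 ?enorm_ge0// mulr_ge0// ltW.
have L0 := L_gt0; have eps0 := eps_gt0; have MB0 := MB_ge0.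
(* If |x l - xstar| <= t and |x l.+1 - x l| <= t, then K * t bounds both the norm
   of the subgradient and the excess of the objective over its value at xstar. *)
pose K := 4 * G + L + 2 * (MB + Mu) + 1.
have K1 : 1 <= K by rewrite /K; lra.
pose t := Num.min (Num.min 1 (eps / 2)) (Num.min (r / 2) (Num.min (e / K) (e / 2))).
have t0 : 0 < t by rewrite !lt_min ltr01 !divr_gt0//; lra.
have [t1 teps tr tK te] : [/\ t <= 1, 2 * t <= eps, 2 * t <= r, K * t <= e & 2 * t <= e].
  have := lexx t; rewrite {2}/t !le_min => /andP[/andP[? h1] /and3P[h2 h3 h4]].
  rewrite ler_pdivlMr ?(lt_le_trans _ K1)// in h3.
  by split=> //; first [lra | rewrite mulrC].
(* From iteration N on, a successful step near xstar decreases the objective by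
   too little to be longer than t. *)
have [|N NP] := @obj_val_diff_small (c1 * (mumin / 2 * t ^+ 2)).
  by rewrite !mulr_gt0// ?invr_gt0// exprn_gt0.
have [k Nk kt] := acc_frequently N t0.
have [|l [kl xlk sl]] := @eventually_successful k; first by lra.
have lt : enorm (x l - xstar) <= t by rewrite xlk.
have [ymin ystep] := success_step sl.
have mul : mu l <= Mu by apply: MuP; lra.
have mul0 := run_mu_ge l.
set y := x l.+1 in ymin ystep.
have D : enorm (y - x l) <= t.
  have := NP l (leq_trans Nk kl); have sq0 := sqr_ge0 (enorm (y - x l)).
  rewrite leNgt => h; apply/negP => big.
  have : t ^+ 2 < enorm (y - x l) ^+ 2.
    by rewrite ltr_pXn2r ?nnegrE ?enorm_ge0// ltW.
  have : mumin / 2 * enorm (y - x l) ^+ 2 <= mu l / 2 * enorm (y - x l) ^+ 2.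
    by rewrite ler_wpM2r//; lra.
  rewrite -(ler_pM2l c1_gt0) => h1.
  rewrite -(ltr_pM2l (_ : 0 < c1 * (mumin / 2))) ?mulr_gt0 ?invr_gt0// => h2.
  by move: h ystep; rewrite -/y; lra.
have yx : enorm (y - xstar) <= 2 * t.
  by apply: (le_trans (ler_enorm_dist (x l) _ _)); lra.
have yeps : enorm (y - xstar) <= eps by lra.
have leps : enorm (x l - xstar) <= eps by lra.
have Eq : phi y = (phi_val l.+1)%:E := phi_valE _.
have dom_l : phi y \is a fin_num by rewrite Eq.
have mu_l : `|mu l| <= Mu.
  by rewrite ger0_norm// (le_trans _ mul0)// ltW.
exists y, (grad f y - (grad f (x l) + (y - x l) *m B l + mu l *: (y - x l))),
  (obj_val l.+1); split.
- by lra.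
- rewrite subr0 -addrA opprD addrA.
  apply: (le_trans (ler_enormB _ _)).
  have h1 := grad_lip yeps leps.
  have h2 : enorm ((y - x l) *m B l) <= MB * t.
    apply: (le_trans (ler_enorm_opnorm _ _)).
    by rewrite ler_pM ?opnorm_ge0 ?enorm_ge0.
  have h3 : enorm (mu l *: (y - x l)) <= Mu * t.
    by rewrite enormZ ler_pM ?enorm_ge0.
  have h4 := ler_enormD ((y - x l) *m B l) (mu l *: (y - x l)).
  have : L * enorm (y - x l) <= L * t by rewrite ler_wpM2l// ltW.
  have : 0 <= G * t by rewrite mulr_ge0// ltW.
  have : 0 <= MB * t by rewrite mulr_ge0// ltW.
  have : 0 <= Mu * t by rewrite mulr_ge0// ltW.
  by move: tK; rewrite /K; lra.
- exact: obj_valE.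
- have Q v : enorm v <= t ->
      `|quad_model (grad f (x l)) (B l) (mu l) v| <= (G + MB + Mu) * t.
    move=> vt; have v0 := enorm_ge0 v.
    have [gG _ _] := f_local leps star_close.
    rewrite /quad_model -addrA; apply: (le_trans (ler_normD _ _)).
    rewrite -[G + MB + Mu]addrA [leRHS]mulrDl; apply: lerD.
      exact: le_trans (cauchy_schwarz (grad f (x l)) v) (ler_pM (enorm_ge0 _) v0 gG vt).
    apply: (le_trans (quad_rem_le (mu l) v (B_bounded l))).
    rewrite ler_pM ?addr_ge0 ?sqr_ge0 ?lerD2l// expr2.
    by rewrite (le_trans _ vt)// ler_piMl// (le_trans vt).
  have := min_reg_model_le ymin Eq EPs.
  have := Q _ D; have := Q (xstar - x l); rewrite enormC => /(_ lt).
  rewrite !ler_norml => /andP[_ h1] /andP[h2 _] h3.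
  have [_ + _] := f_local yeps star_close.
  have : G * enorm (y - xstar) <= G * (2 * t) by rewrite ler_wpM2l.
  rewrite -/G ler_norml => h4 /andP[_ h5].
  have : ((f xstar + Ps - e)%:E < objective f phi y)%E by apply/VF/rV; lra.
  rewrite (obj_valE l.+1) lte_fin => h6.
  have Lt := mulr_ge0 (ltW L_gt0) (ltW t0).
  move: tK h6; rewrite /K /obj_val -/y => tK h6.
  apply/andP; split; first by lra.
  by lra.
- by apply: regular_subdiff_reg_model_min => //; [exact: run_sym|exact: f_diff].
Qed.

End AlgorithmRun.

(** * Stationarity of accumulation points *)

Theorem theorem3p15 (R : realType) (n : nat)
    (f : 'rV[R]_n -> R) (phi : 'rV[R]_n -> \bar R)
    (c1 sigma2 mumin mumax MB : R)
    (x : nat -> 'rV[R]_n) (B : nat -> 'M[R]_n) (mu : nat -> R)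
    (xhat : nat -> option 'rV[R]_n)
    (phi_ninfty : forall z, phi z != -oo%E)
    (F_proper : proper_fun (objective f phi))
    (F_lsc : lower_semicontinuous (objective f phi))
    (f_C1 : exists U : set 'rV[R]_n,
        [/\ open U, edom phi `<=` U & C1_on U f])
    (phi_proper : proper_fun phi)
    (phi_lsc : lower_semicontinuous phi)
    (phi_prox_bounded : prox_bounded phi)
    (F_bounded_below : (-oo < ereal_inf (range (objective f phi)))%E)
    (c1_bounds : 0 < c1 < 1)
    (sigma2_gt1 : 1 < sigma2)
    (mumin_gt0 : 0 < mumin)
    (mumin_le_mumax : mumin <= mumax)
    (run : algorithm_run f phi c1 sigma2 mumin mumax x B mu xhat)
    (MB_gt0 : 0 < MB)
    (B_bounded : forall k, opnorm (B k) <= MB)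
    (grad_loc_lipschitz : forall z, edom phi z ->
        exists L eps : R, [/\ 0 < L, 0 < eps &
          forall y w, enorm (y - z) <= eps -> enorm (w - z) <= eps ->
            enorm (grad f y - grad f w) <= L * enorm (y - w)])
    (xstar : 'rV[R]_n)
    (xstar_acc : cluster (x k @[k --> \oo]) xstar) :
  limiting_subdiff (objective f phi) xstar 0.
Proof.
have [c10 c11] := andP c1_bounds.
have dstar : edom phi xstar by apply: acc_edom run _ _ _ => //.
have [U [oU dU fU]] := f_C1.
have /nbhs_enormP[r r0 rU] : nbhs xstar U by apply: open_nbhs_nbhs; split=> //; exact: dU.
have [L [eps [L0 eps0 lip]]] := grad_loc_lipschitz _ dstar.
pose del := Num.min r eps.
apply: (@acc_stationary _ _ _ _ _ _ _ _ _ _ _ _ phi_ninfty c10 c11 sigma2_gt1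
  mumin_gt0 run F_bounded_below F_lsc xstar xstar_acc phi_lsc phi_prox_bounded
  MB L del B_bounded) => //.
- by rewrite /del lt_min r0.
- by move=> y; rewrite le_min => /andP[/rU/fU[]].
- by move=> y w; rewrite !le_min => /andP[_ ?] /andP[_ ?]; exact: lip.
Qed.
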